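(* Let $X$ be a real random variable that is bounded above, with distribution function $F_X$ and $\mathcal M=\sup\{x:\mathbb P(X\le x)<1\}$. Suppose $X$ lies in the Weibull regime with parameter $\alpha>0$, i.e. $x\mapsto 1-F_X(\mathcal M-x)$ is regularly varying at $0$ of index $\alpha$. For $\theta>0$ let $X_\theta$ be a random variable with law $$\mathbb P(X_\theta\in A)=\frac{\mathbb E[e^{\theta X}\mathbf 1_{X\in A}]}{\mathbb E[e^{\theta X}]}.$$ Then for every sequence $\theta_n\to\infty$, $$\theta_n(\mathcal M-X_{\theta_n})\xrightarrow{d}\Gamma(\alpha,1).$$
   Context: A function $f$ is regularly varying at $0$ with index $\alpha$ if $\lim_{t\downarrow0}f(tu)/f(t)=u^\alpha$ for all $u>0$. $\Gamma(a,b)$ denotes a positive random variable with density $\frac{b^a}{\Gamma(a)}x^{a-1}e^{-bx}$, $x>0$. $\xrightarrow{d}$ is convergence in distribution. *)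

(* Defs.v *)
From HB Require Import structures.
From mathcomp Require Import all_boot all_order all_algebra.
From mathcomp Require Import all_classical all_reals all_analysis measurable_realfun.
From mathcomp Require Import ring lra.
Set Implicit Arguments.
Unset Strict Implicit.
Unset Printing Implicit Defensive.
Import Order.TTheory GRing.Theory Num.Theory.
Import numFieldNormedType.Exports.
Local Open Scope classical_set_scope.
Local Open Scope ring_scope.

Section gamma.
Context {R : realType}.
Notation mu := (@lebesgue_measure R).
Implicit Types a b x : R.

Definition gamma_kernel a x : R := x `^ (a - 1) * expR (- x).

Definition gamma_fun a : R := \int[mu]_(x in `]0, +oo[) gamma_kernel a x.

Definition gamma_pdf a b : R -> R :=
  (fun x => b `^ a / gamma_fun a * x `^ (a - 1) * expR (- (b * x)))
    \_ `]0, +oo[.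

Definition gamma_prob a b (A : set R) : \bar R :=
  (\int[mu]_(x in A) (gamma_pdf a b x)%:E)%E.

Lemma gamma_kernel_ge0 a x : 0 <= gamma_kernel a x.
Proof. by rewrite mulr_ge0 ?powR_ge0 ?expR_ge0. Qed.

Lemma gamma_fun_ge0 a : 0 <= gamma_fun a.
Proof. by apply: Rintegral_ge0 => x _; exact: gamma_kernel_ge0. Qed.

Lemma gamma_pdf_ge0 a b x : 0 <= gamma_pdf a b x.
Proof.
apply: restrict_ge0 => {}x _.
by rewrite !mulr_ge0 ?powR_ge0 ?expR_ge0 ?invr_ge0 ?gamma_fun_ge0.
Qed.

Lemma measurable_gamma_kernel a (D : set R) :
  measurable D -> measurable_fun D (gamma_kernel a).
Proof.
move=> mD; apply: measurable_funTS; apply: measurable_funM.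
  exact: measurable_powR.
by apply: measurableT_comp => //; exact: measurable_funN.
Qed.

Lemma measurable_gamma_pdf a b : measurable_fun [set: R] (gamma_pdf a b).
Proof.
apply/measurable_restrict => //; apply: measurable_funTS.
apply: measurable_funM.
  by apply: measurable_funM => //; exact: measurable_powR.
apply: measurableT_comp => //; apply: measurable_funN.
exact: measurable_funM.
Qed.

Lemma derivable_powR_pos a x : 0 < x -> derivable (fun y => y `^ a) x 1.
Proof. by move=> x0; apply: derivable_powR; rewrite in_itv/= x0. Qed.

Lemma continuous_powR_pos a x : 0 < x -> {for x, continuous (fun y => y `^ a)}.
Proof.
move=> x0; apply: differentiable_continuous.
by apply/derivable1_diffP; exact: derivable_powR_pos.
Qed.

Lemma continuous_gamma_kernel a x : 0 < x -> {for x, continuous (gamma_kernel a)}.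
Proof.
move=> x0; apply: continuousM; first exact: continuous_powR_pos.
by apply: continuous_comp; [exact: continuousN|exact: continuous_expR].
Qed.


Let S (c : R) (n : nat) : set R := `[c / n.+1%:R, +oo[.

Let S_cover (c : R) : 0 < c -> \bigcup_n S c n = `]0, +oo[%classic.
Proof.
move=> c0; apply/seteqP; split => [x [n _]|x]; rewrite /S /= !in_itv/= !andbT.
  by apply: lt_le_trans; rewrite divr_gt0.
move=> x0; exists (Num.truncn (c / x)) => //=; rewrite in_itv/= andbT.
by rewrite ler_pdivrMr// mulrC -ler_pdivrMr// ltW// truncnS_gt.
Qed.

Let S_nd (c : R) : 0 < c -> nondecreasing_seq (S c).
Proof.
move=> c0 m n mn; apply/subsetPset => x; rewrite /S /= !in_itv/= !andbT.
by apply: le_trans; rewrite ler_pM2l// lef_pV2 ?posrE// ler_nat.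
Qed.

Let S_cvg c (f : R -> R) : 0 < c -> measurable_fun [set: R] f ->
  (forall x, 0 < x -> 0 <= f x) ->
  (\int[mu]_(x in S c n) (f x)%:E @[n --> \oo]
     --> \int[mu]_(x in `]0%R, +oo[) (f x)%:E)%E.
Proof.
move=> c0 mf f0; rewrite -(S_cover c0).
apply: ge0_nondecreasing_set_cvg_integral => //.
- exact: S_nd.
- by move=> n; exact: measurable_itv.
- move=> n; apply: measurableT_comp => //; exact: measurable_funTS.
- move=> n x; rewrite /S /= in_itv/= andbT => nx; rewrite lee_fin f0//.
  by rewrite (lt_le_trans _ nx)// divr_gt0.
Qed.

(* Up to a constant, gamma_kernel is dominated on ]0, +oo[ by the derivative
   dom_fun of the bounded function x |-> (x / (1 + x)) `^ a. *)
Let dom_fun a x : R := a * (1 - (1 + x)^-1) `^ (a - 1) * (1 + x) ^- 2.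

Let dom_prim a x : R := (1 - (1 + x)^-1) `^ a.

Let ratioE x : 0 < x -> 1 - (1 + x)^-1 = x / (1 + x).
Proof. by move=> x0; field; rewrite gt_eqF// addr_gt0. Qed.

Let ratio_gt0 x : 0 < x -> 0 < 1 - (1 + x)^-1.
Proof. by move=> x0; rewrite ratioE// divr_gt0// addr_gt0. Qed.

Let is_derive_dom_prim a x : 0 < x ->
  is_derive x 1 (dom_prim a) (dom_fun a x).
Proof.
move=> x0; have x1 : 1 + x != 0 by rewrite gt_eqF// addr_gt0.
have h := is_derive1_powR a (ratio_gt0 x0).
have h2 : is_derive x 1 (fun x : R => 1 - (1 + x)^-1) ((1 + x) ^- 2).
  apply: is_derive_eq.
  by rewrite add0r mul1r scaleNr opprK [_ *: _]mulr1.
exact: (@is_derive1_comp _ (fun y : R => y `^ a) (fun x : R => 1 - (1 + x)^-1) x _ _ h h2).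
Qed.


Let dom_prim_cvg a : dom_prim a x @[x --> +oo] --> (1 : R).
Proof.
have <- : 1 `^ a = 1 :> R by rewrite powR1.
rewrite /dom_prim.
suff h : 1 - (1 + x)^-1 @[x --> +oo] --> (1 : R).
  exact: (cvg_comp _ _ h (@continuous_powR_pos a 1 ltr01)).
rewrite -[X in _ --> X]subr0; apply: cvgB; first exact: cvg_cst.
apply/gtr0_cvgV0; last exact: cvg_addrl.
by near=> x; rewrite addr_gt0.
Unshelve. all: by end_near. Qed.

Let continuous_dom_fun a x : 0 < x -> {for x, continuous (dom_fun a)}.
Proof.
move=> x0; apply: differentiable_continuous.
have x1 : 1 + x != 0 by rewrite gt_eqF// addr_gt0.
have x2 : (1 + x) ^+ 2 != 0 by rewrite expf_neq0.
have h := is_derive1_powR (a - 1) (ratio_gt0 x0).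
have h2 : is_derive x 1 (fun x : R => 1 - (1 + x)^-1) ((1 + x) ^- 2).
  apply: is_derive_eq.
  by rewrite add0r mul1r scaleNr opprK [_ *: _]mulr1.
have h3 := @is_derive1_comp _ (fun y : R => y `^ (a - 1))
  (fun x : R => 1 - (1 + x)^-1) x _ _ h h2.
apply/derivable1_diffP; apply: derivableM => //.
Qed.

Let dom_fun_ge0 a x : 0 < a -> 0 < x -> 0 <= dom_fun a x.
Proof.
move=> a0 x0; rewrite /dom_fun !mulr_ge0 ?powR_ge0 ?(ltW a0)//.
by rewrite invr_ge0 exprn_ge0// addr_ge0// ltW.
Qed.

Let kernel_le_dom a x : 0 < a -> 0 < x ->
  gamma_kernel a x <= (a + 1) `^ (a + 1) / a * dom_fun a x.
Proof.
move=> a0 x0; set c := a + 1.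
have c0 : 0 < c by rewrite /c addr_gt0.
have x10 : 0 < 1 + x by rewrite addr_gt0.
have -> : dom_fun a x = a * (x `^ (a - 1) * (1 + x) `^ (- c)).
  rewrite /dom_fun ratioE// powRM ?invr_ge0 ?(ltW x0) ?(ltW x10)//.
  rewrite -!mulrA; congr (_ * (_ * _)).
  rewrite -powR_inv1 ?(ltW x10)// -powRrM -powR_invn ?(ltW x10)// -powRD.
    by congr (_ `^ _); rewrite /c; ring.
  by rewrite (gt_eqF x10) implybT.
have -> : c `^ c / a * (a * (x `^ (a - 1) * (1 + x) `^ (- c))) =
    x `^ (a - 1) * (c `^ c * (1 + x) `^ (- c)).
  by field; rewrite gt_eqF.
rewrite /gamma_kernel ler_wpM2l ?powR_ge0// powRN ler_pdivlMr ?powR_gt0//.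
rewrite expRN ler_pdivrMl ?expR_gt0//.
have -> : expR x * c `^ c = (c * expR (x / c)) `^ c.
  rewrite powRM ?expR_ge0 ?(ltW c0)// -expRM mulrC.
  by congr (_ * expR _); field; rewrite gt_eqF.
apply: ge0_ler_powR; rewrite ?nnegrE ?(ltW c0) ?(ltW x10)//.
  by rewrite mulr_ge0 ?expR_ge0 ?(ltW c0).
apply: (@le_trans _ _ (c * (1 + x / c))).
  rewrite mulrDr mulr1 mulrCA divff ?gt_eqF// mulr1 lerD2r /c.
  by rewrite lerDr ltW.
by rewrite ler_pM2l// expR_ge1Dx.
Qed.

Let within_dom_fun a s : 0 < s ->
  {within `[s, +oo[, continuous (dom_fun a)}.
Proof.
move=> s0; apply/continuous_within_itvcyP; split.
  move=> x; rewrite in_itv/= andbT => sx.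
  by apply: continuous_dom_fun; exact: lt_trans sx.
by apply: cvg_at_right_filter; exact: continuous_dom_fun.
Qed.

Let int_dom_fun a s : 0 < a -> 0 < s ->
  (\int[mu]_(x in `[s, +oo[) (dom_fun a x)%:E <= 1%:E)%E.
Proof.
move=> a0 s0.
rewrite (@ge0_continuous_FTC2y _ _ (dom_prim a) s 1).
- by rewrite -EFinB lee_fin gerBl powR_ge0.
- by move=> x sx; apply: dom_fun_ge0 => //; exact: lt_le_trans sx.
- exact: within_dom_fun.
- exact: dom_prim_cvg.
- move=> x sx; apply: ex_derive; apply: is_derive_dom_prim.
  exact: lt_trans sx.
- apply: cvg_at_right_filter; apply: differentiable_continuous.
  by apply/derivable1_diffP; apply: ex_derive; exact: is_derive_dom_prim.
- move=> x; rewrite in_itv/= andbT => sx.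
  rewrite derive1E; apply: derive_val; apply: is_derive_dom_prim.
  exact: lt_trans sx.
Qed.

Let mkernel a : measurable_fun [set: R] (gamma_kernel a).
Proof. exact: measurable_gamma_kernel. Qed.

Lemma gamma_kernel_int_lty a : 0 < a ->
  (\int[mu]_(x in `]0%R, +oo[) (gamma_kernel a x)%:E < +oo)%E.
Proof.
move=> a0; apply: (@le_lt_trans _ _ ((a + 1) `^ (a + 1) / a)%:E); last exact: ltry.
have k0 : 0 <= (a + 1) `^ (a + 1) / a by rewrite divr_ge0 ?powR_ge0 ?ltW.
have cv := S_cvg ltr01 (@mkernel a) (fun x _ => gamma_kernel_ge0 a x).
have <- := cvg_lim _ cv; last by [].
apply: lime_le; first by apply/cvg_ex; eexists; exact: cv.
near=> n; have s0 : 0 < 1 / n.+1%:R :> R by rewrite divr_gt0.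
have cont : measurable_fun (S 1 n) (dom_fun a).
  apply: subspace_continuous_measurable_fun; first exact: measurable_itv.
  exact: within_dom_fun.
apply: (@le_trans _ _ (\int[mu]_(x in S 1 n)
    (((a + 1) `^ (a + 1) / a)%:E * (dom_fun a x)%:E))%E).
  apply: ge0_le_integral => //.
  - exact: measurable_itv.
  - by move=> x _; rewrite lee_fin gamma_kernel_ge0.
  - by apply: measurableT_comp => //; apply: measurable_gamma_kernel; exact: measurable_itv.
  - by apply: measurable_funeM; exact: measurableT_comp.
  - move=> x; rewrite /S /= in_itv/= andbT => sx; rewrite lee_fin.
    by apply: kernel_le_dom => //; exact: lt_le_trans sx.
rewrite ge0_integralZl//.
- rewrite -[leRHS]mule1 lee_wpmul2l ?lee_fin//; exact: int_dom_fun.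
- exact: measurable_itv.
- exact: measurableT_comp.
- move=> x; rewrite /S /= in_itv/= andbT => sx; rewrite lee_fin.
  by apply: dom_fun_ge0 => //; exact: lt_le_trans sx.
Unshelve. all: by end_near. Qed.

Lemma gamma_funE a : 0 < a ->
  (\int[mu]_(x in `]0%R, +oo[) (gamma_kernel a x)%:E)%E = (gamma_fun a)%:E.
Proof.
move=> a0; rewrite /gamma_fun /Rintegral fineK// ge0_fin_numE.
  exact: gamma_kernel_int_lty.
by apply: integral_ge0 => x _; rewrite lee_fin gamma_kernel_ge0.
Qed.

Lemma gamma_fun_gt0 a : 0 < a -> 0 < gamma_fun a.
Proof.
move=> a0; rewrite -lte_fin -gamma_funE//.
apply: (@lt_le_trans _ _ (expR (- 2) / 2)%:E).
  by rewrite lte_fin divr_gt0 ?expR_gt0.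
apply: (@le_trans _ _ (\int[mu]_(x in `[1%R, 2%R]) (gamma_kernel a x)%:E)%E).
  apply: (@le_trans _ _ (\int[mu]_(x in `[1%R, 2%R]) (expR (- 2) / 2)%:E)%E).
    rewrite integral_cst//= lebesgue_measure_itv/= lte_fin ltr1n -EFinD.
    by rewrite -EFinM lee_fin [(2 - 1 : R)](_ : _ = 1) ?mulr1//; ring.
  apply: ge0_le_integral => //.
  - by apply: measurableT_comp => //; apply: measurable_gamma_kernel; exact: measurable_itv.
  - move=> x; rewrite /= in_itv/= => /andP[x1 x2]; rewrite lee_fin mulrC.
    have x0 : 0 < x by exact: lt_le_trans x1.
    apply: ler_pM; rewrite ?invr_ge0 ?expR_ge0// ?ler_expR ?lerN2//.
    rewrite powRB ?(gt_eqF x0) ?implybT// powRr1 ?(ltW x0)//.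
    rewrite -[leLHS]mul1r ler_pM ?invr_ge0//.
    + by rewrite -(powRr0 x) ler_powR// ltW.
    + by rewrite lef_pV2 ?posrE.
apply: ge0_subset_integral => //.
- by apply: measurableT_comp => //; apply: measurable_gamma_kernel; exact: measurable_itv.
- by move=> x _; rewrite lee_fin gamma_kernel_ge0.
- by move=> x /=; rewrite !in_itv/= andbT => /andP[x1 _]; exact: lt_le_trans x1.
Qed.

Let scale_S a b n : 0 < b ->
  (\int[mu]_(x in S b n) (gamma_kernel a x)%:E =
   \int[mu]_(x in S 1 n) (gamma_kernel a (b * x) * b)%:E)%E.
Proof.
move=> b0; rewrite /S.
have -> : b / n.+1%:R = b * (1 / n.+1%:R) by rewrite mul1r.
set s := 1 / _; have s0 : 0 < s by rewrite divr_gt0.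
have dF : (fun x : R => b * x)^`()%classic = cst b.
  apply/funext => x; rewrite derive1E; apply: derive_val.
  by apply: is_derive_eq; rewrite [LHS]mulr1.
have cF : continuous (fun x : R => b * x) by exact: mulrl_continuous.
rewrite (@increasing_ge0_integration_by_substitutiony _ (fun x => b * x)
  (gamma_kernel a) s).
- by rewrite dF.
- by move=> x y _ _ xy; rewrite ltr_pM2l.
- by rewrite dF => ? _; exact: cst_continuous.
- by rewrite dF; exact: is_cvg_cst.
- by rewrite dF; exact: is_cvg_cst.
- split; first by move=> x _; exact: derivableM.
  by apply: cvg_at_right_filter; exact: cF.
- exact: gt0_cvgMry.
- apply/continuous_within_itvcyP; split.
    move=> x; rewrite in_itv/= andbT => sx; apply: continuous_gamma_kernel.
    by apply: lt_trans sx; rewrite mulr_gt0.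
  apply: cvg_at_right_filter; apply: continuous_gamma_kernel.
  by rewrite mulr_gt0.
- by move=> x _; exact: gamma_kernel_ge0.
Qed.

Lemma gamma_kernel_scale a b : 0 < b ->
  (\int[mu]_(x in `]0%R, +oo[) (gamma_kernel a (b * x) * b)%:E =
   \int[mu]_(x in `]0%R, +oo[) (gamma_kernel a x)%:E)%E.
Proof.
move=> b0.
have h := S_cvg b0 (@mkernel a) (fun x _ => gamma_kernel_ge0 a x).
suff h2 : (\int[mu]_(x in S b n) (gamma_kernel a x)%:E @[n --> \oo] -->
    \int[mu]_(x in `]0%R, +oo[) (gamma_kernel a (b * x) * b)%:E)%E.
  exact: (cvg_unique _ h2 h).
under eq_fun do rewrite scale_S//.
apply: (@S_cvg 1 (fun x => gamma_kernel a (b * x) * b) ltr01).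
  apply: measurable_funM => //.
  apply: (measurableT_comp (@mkernel a)).
  exact: measurable_funM.
by move=> x _; rewrite mulr_ge0 ?gamma_kernel_ge0// ltW.
Qed.

Let gamma_prob0 a b : gamma_prob a b set0 = 0%E.
Proof. by rewrite /gamma_prob integral_set0. Qed.

Let gamma_prob_ge0 a b A : (0 <= gamma_prob a b A)%E.
Proof. by apply: integral_ge0 => x _; rewrite lee_fin gamma_pdf_ge0. Qed.

Let gamma_prob_sigma_additive a b : semi_sigma_additive (gamma_prob a b).
Proof.
move=> /= F mF tF mUF; rewrite /gamma_prob; apply: cvg_toP.
  apply: ereal_nondecreasing_is_cvgn => m n mn.
  apply: lee_sum_nneg_natr => // k _ _; apply: integral_ge0 => /= x Fkx.
  by rewrite lee_fin gamma_pdf_ge0.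
rewrite ge0_integral_bigcup//=.
- apply/measurable_funTS/measurableT_comp => //.
  exact: measurable_gamma_pdf.
- by move=> x _; rewrite lee_fin gamma_pdf_ge0.
Qed.

HB.instance Definition _ a b := isMeasure.Build _ _ _ (gamma_prob a b)
  (gamma_prob0 a b) (@gamma_prob_ge0 a b) (@gamma_prob_sigma_additive a b).

Section probability.
Variables (a b : R).
Hypotheses (a0 : 0 < a) (b0 : 0 < b).

Lemma gamma_prob_setT : gamma_prob a b [set: R] = 1%E.
Proof.
rewrite /gamma_prob /gamma_pdf.
transitivity (\int[mu]_(x in `]0%R, +oo[)
    (b `^ a / gamma_fun a * x `^ (a - 1) * expR (- (b * x)))%:E)%E.
  rewrite [RHS]integral_mkcond/=.
  by under [RHS]eq_integral do rewrite restrict_EFin.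
have E x : `]0, +oo[%classic x ->
    (b `^ a / gamma_fun a * x `^ (a - 1) * expR (- (b * x)))%:E =
    ((gamma_fun a)^-1%:E * (gamma_kernel a (b * x) * b)%:E)%E.
  rewrite /= in_itv/= andbT => x0; rewrite -EFinM; congr EFin.
  rewrite /gamma_kernel powRM ?(ltW b0) ?(ltW x0)//.
  rewrite -(mulr_powRB1 (ltW b0) a0); ring.
under eq_integral => x /set_mem xD do rewrite (E x xD).
rewrite ge0_integralZl//.
- by rewrite gamma_kernel_scale// gamma_funE// -EFinM mulVf// gt_eqF// gamma_fun_gt0.
- apply/measurable_EFinP; apply: measurable_funTS; apply: measurable_funM => //.
  by apply: (measurableT_comp (@mkernel a)); exact: measurable_funM.
- by move=> x _; rewrite lee_fin mulr_ge0 ?gamma_kernel_ge0// ltW.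
- by rewrite lee_fin invr_ge0 gamma_fun_ge0.
Qed.

HB.instance Definition _ :=
  @Measure_isProbability.Build _ _ R (gamma_prob a b) gamma_prob_setT.

Definition gamma_probability : probability _ R := gamma_prob a b.

End probability.

End gamma.

Definition regularly_varying_at0 {R : realType} (f : R -> R) (alpha : R) :=
  forall u, 0 < u -> f (t * u) / f t @[t --> 0^'+] --> u `^ alpha.

(* Each X n may live on its own probability space; the limit is a law on R. *)
Definition cvg_in_distribution {R : realType} (d : nat -> measure_display)
    (T : forall n, measurableType (d n)) (P : forall n, probability (T n) R)
    (X : forall n, {RV (P n) >-> R}) (nu : probability R R) :=
  forall x : R, {for x, continuous (fun y : R => nu `]-oo, y]%classic)} ->
    cdf (X n) x @[n --> \oo] --> nu `]-oo, x]%classic.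

Definition bounded_above {R : realType} {d} {T : measurableType d}
    (P : probability T R) (X : {RV P >-> R}) :=
  exists B : R, \forall w \ae P, X w <= B.

Definition right_endpoint {R : realType} {d} {T : measurableType d}
    (P : probability T R) (X : {RV P >-> R}) : R :=
  sup [set x : R | (cdf X x < 1)%E].

Definition weibull_regime {R : realType} {d} {T : measurableType d}
    (P : probability T R) (X : {RV P >-> R}) (alpha : R) :=
  regularly_varying_at0
    (fun x => 1 - fine (cdf X (right_endpoint X - x))) alpha.

(* Y, possibly on another probability space, has the exponentially tilted law
   of X. *)
Definition has_tilted_law {R : realType} {d} {T : measurableType d}
    (P : probability T R) (X : {RV P >-> R}) (theta : R)
    {d'} {T' : measurableType d'} (P' : probability T' R)
    (Y : {RV P' >-> R}) :=
  forall A : set R, measurable A ->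
    distribution P' Y A =
    ('E_P[(fun w => expR (theta * X w) * \1_(X @^-1` A) w)%R]
      / 'E_P[(fun w => expR (theta * X w))%R])%E.

(* Main.v *)
(** Write Y = M - X, with distribution function H, and t = 1/theta.  Since
    [expR (- z)] is the integral of [expR (- v)] over [v >= z], Fubini's theorem
    gives, for A = ]-oo, x],
      E[exp(- theta Y); theta Y in A]
        = \int exp(- v) P(theta Y <= min(v, x)) dv
        = \int exp(- v) H(t min(v, x)) dv.
    Dividing by G(t) = P(Y < t), regular variation makes the integrand converge
    to exp(- v) max(0, min(v, x))^alpha, and a Potter bound allows dominated
    convergence.  The same Fubini identity applied to the density
    y^(alpha - 1) 1_{y > 0} identifies the limit as
    alpha Gamma(alpha) gamma_prob alpha 1 A.  The tilted distribution function
    is the ratio of these integrals for A = ]-oo, x] and for A = R. *)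
Require Import Defs.
From HB Require Import structures.
From mathcomp Require Import all_boot all_order all_algebra.
From mathcomp Require Import all_classical all_reals all_analysis measurable_realfun.
From mathcomp Require Import ring lra.
Set Implicit Arguments.
Unset Strict Implicit.
Unset Printing Implicit Defensive.
Import Order.TTheory GRing.Theory Num.Theory.
Import numFieldNormedType.Exports.
Local Open Scope classical_set_scope.
Local Open Scope ring_scope.

(** * Fubini formula for exponential integrals *)

Lemma integral_expRN_itv_cy (R : realType) (z : R) :
  (\int[lebesgue_measure]_(v in `[z, +oo[) (expR (- v))%:E = (expR (- z))%:E)%E.
Proof.
have dE (x : R) : is_derive x 1 (fun v : R => - expR (- v)) (expR (- x)).
  apply: is_derive_eq.
  by rewrite mulrN1 opprK.
rewrite (@ge0_continuous_FTC2y _ _ (fun v => - expR (- v)) z 0).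
- by rewrite sub0e -EFinN opprK.
- by move=> x _; exact: expR_ge0.
- apply: continuous_subspaceT => x.
  by apply: continuous_comp; [exact: continuousN|exact: continuous_expR].
- rewrite -oppr0; apply: cvgN.
  exact: cvgr_expR.
- by move=> x _; exact: ex_derive.
- apply: cvg_at_right_filter; apply: cvgN.
  by apply: continuous_comp; [exact: continuousN|exact: continuous_expR].
- by move=> x _; rewrite derive1E; exact: derive_val.
Qed.

(* [h] represents truncation to [A]: it is [id] for [A = setT] and
   [fun v => Num.min v x] for [A = `]-oo, x]]. *)
Lemma integral_expRN_layer (d : measure_display) (T : measurableType d)
    (R : realType) (m : {sigma_finite_measure set T -> \bar R})
    (Z w : T -> R) (A : set R) (h : R -> R) :
  measurable_fun setT Z -> measurable_fun setT w -> (forall x, 0 <= w x) ->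
  measurable A -> (forall z v, z <= h v <-> A z /\ z <= v) ->
  (\int[m]_(x in Z @^-1` A) (w x * expR (- Z x))%:E =
   \int[lebesgue_measure]_v
     ((expR (- v))%:E * \int[m]_(x in [set x | (Z x <= h v)%R]) (w x)%:E))%E.
Proof.
move=> mZ mw w0 mA hA.
(* The section of [E] over a point x with [Z x] in [A] is [[Z x], +oo[, whose exponential integral
   is exp(- [Z x]). Its section over v is {[Z] <= [h v]}, by the hypothesis on [h]. *)
pose E : set (T * R) := [set p | A (Z p.1) /\ Z p.1 <= p.2].
have mE : measurable E.
  apply: (@measurableI _ _ [set p : T * R | A (Z p.1)] [set p | Z p.1 <= p.2]).
    rewrite -[X in measurable X]setTI.
    by apply: (measurableT_comp mZ measurable_fst).
  rewrite -[X in measurable X]setTI.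
  apply: measurable_fun_le => //.
  exact: (measurableT_comp mZ measurable_fst).
pose f : T * R -> \bar R := (fun p => (w p.1 * expR (- p.2))%:E) \_ E.
have mf : measurable_fun setT f.
  apply/(measurable_restrict _ mE measurableT).
  apply: measurable_funTS; apply/measurable_EFinP; apply: measurable_funM.
    exact: (measurableT_comp mw measurable_fst).
  apply: measurableT_comp => //.
  exact: (measurableT_comp _ measurable_snd).
have f0 p : (0 <= f p)%E.
  by apply: erestrict_ge0 => q _; rewrite lee_fin mulr_ge0 ?expR_ge0.
transitivity (\int[m]_x \int[lebesgue_measure]_v f (x, v))%E.
  rewrite integral_mkcond; apply: eq_integral => x _.
  rewrite /patch; case: ifPn => [/set_mem Ax|/negP Ax].
    transitivity (\int[lebesgue_measure]_(v in `[Z x, +oo[)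
        ((w x)%:E * (expR (- v))%:E))%E.
      rewrite ge0_integralZl ?integral_expRN_itv_cy//.
      - apply: measurable_funTS; apply/measurable_EFinP.
        by apply: measurableT_comp => //; exact: measurable_funN.
      - by rewrite lee_fin; exact: w0.
    rewrite integral_mkcond; apply: eq_integral => v _.
    rewrite /f /patch; congr (if _ then _ else _).
    apply/idP/idP => /set_mem.
      by rewrite /= in_itv/= andbT => xv; exact/mem_set.
    by move=> [_ xv]; apply/mem_set; rewrite /= in_itv/= andbT.
  rewrite integral0_eq// => v _; rewrite /f /patch ifF//.
  by apply/negP => /set_mem[Av _]; apply: Ax; exact: mem_set.
rewrite (@fubini_tonelli _ _ _ _ _ m (@lebesgue_measure R) f mf f0); apply: eq_integral => v _.
rewrite -ge0_integralZl//; last 3 first.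
- rewrite -[X in measurable X]setTI; exact: measurable_fun_le.
- by apply: measurable_funTS; exact/measurable_EFinP.
- by move=> x _; rewrite lee_fin; exact: w0.
rewrite [RHS]integral_mkcond; apply: eq_integral => x _.
rewrite /f /patch -EFinM mulrC; congr (if _ then _ else _).
by apply/idP/idP => /set_mem xv; apply/mem_set; apply/hA.
Qed.

(** * Power integrals and the gamma law *)

Lemma integral_powR_itv (R : realType) (a b c : R) : 0 < a -> 0 < b -> b < c ->
  (\int[lebesgue_measure]_(y in `[b, c]) (y `^ (a - 1))%:E =
   (c `^ a / a)%:E - (b `^ a / a)%:E)%E.
Proof.
move=> a0 b0 bc; have pos y : b <= y -> 0 < y by exact: lt_le_trans.
have dF (y : R) : 0 < y -> is_derive y 1 (fun y : R => y `^ a / a) (y `^ (a - 1)).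
  move=> y0; have h := is_derive1_powR a y0.
  by apply: is_derive_eq; rewrite scaler0 add0r [_ *: _]mulrA mulVf ?mul1r// gt_eqF.
have cF (y : R) : 0 < y -> {for y, continuous (fun y : R => y `^ a / a)}.
  by move=> y0; apply: cvgM; [exact: continuous_powR_pos|exact: cvg_cst].
have lec := ltW bc.
rewrite (@continuous_FTC2 _ _ (fun y : R => y `^ a / a))//.
- apply: continuous_in_subspaceT => y /set_mem/=; rewrite in_itv/= => /andP[by_ _].
  by apply: continuous_powR_pos; exact: pos.
- split.
  + move=> y; rewrite in_itv/= => /andP[by_ _].
    by apply: ex_derive; apply: dF; exact/pos/ltW.
  + by apply: cvg_at_right_filter; apply: cF.
  + by apply: cvg_at_left_filter; apply: cF; exact: pos.
- move=> y; rewrite in_itv/= => /andP[by_ _].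
  by rewrite derive1E; apply: derive_val; apply: dF; exact/pos/ltW.
Qed.

(** Evaluates the inner integral of the layer formula for the gamma density. The integrand may blow
    up at 0 when a < 1, so ]0, c] is exhausted by compact intervals away from 0. *)
Lemma integral_powR_le (R : realType) (a c : R) : 0 < a ->
  (\int[lebesgue_measure]_(y in [set y | (y <= c)%R])
     (((fun y => y `^ (a - 1)) \_ `]0%R, +oo[) y)%:E =
   (Num.max 0 c `^ a / a)%:E)%E.
Proof.
move=> a0; transitivity
    (\int[lebesgue_measure]_(y in `]0%R, c]) (y `^ (a - 1))%:E)%E.
  rewrite integral_mkcond [RHS]integral_mkcond; apply: eq_integral => y _.
  rewrite /patch; have [yc|yc] := leP y c.
    rewrite mem_set// !mem_setE !in_itv/= yc !andbT. by case: ifP.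
  rewrite memNset ?mem_setE ?in_itv/=; first by rewrite leNgt yc andbF.
  by apply/negP; rewrite -ltNge.
have [c0|c0] := leP c 0.
  by rewrite set_itv_ge ?bnd_simp -?leNgt// integral_set0 powR0 ?gt_eqF// mul0r.
(* The index [n.+2] keeps the left endpoint strictly below c even at n = 0, as [integral_powR_itv]
   requires. *)
pose F n : set R := `[c / n.+2%:R, c]%classic.
have UF : \bigcup_n F n = `]0, c]%classic.
  apply/seteqP; split => [y [n _]|y]; rewrite /F /= !in_itv/=.
    by move=> /andP[cy ->]; rewrite andbT (lt_le_trans _ cy)// divr_gt0.
  move=> /andP[y0 yc]; exists (Num.truncn (c / y)) => //=; rewrite in_itv/= yc andbT.
  rewrite ler_pdivrMr// mulrC -ler_pdivrMr// ltW//.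
  by apply: lt_le_trans (truncnS_gt _) _; rewrite ler_nat.
rewrite -UF.
have cv1 : (\int[lebesgue_measure]_(y in F n) (y `^ (a - 1))%:E @[n --> \oo] -->
    \int[lebesgue_measure]_(y in \bigcup_n F n) (y `^ (a - 1))%:E)%E.
  apply: ge0_nondecreasing_set_cvg_integral.
  - move=> m n mn; apply/subsetPset => y; rewrite /F /= !in_itv/= => /andP[+ ->].
    by rewrite andbT; apply: le_trans; rewrite ler_pM2l// lef_pV2 ?posrE// ler_nat.
  - by move=> n; exact: measurable_itv.
  - move=> n; apply: measurable_funTS; apply/measurable_EFinP.
    exact: measurable_powR.
  - by move=> n y _; rewrite lee_fin powR_ge0.
have cv2 : (\int[lebesgue_measure]_(y in F n) (y `^ (a - 1))%:E @[n --> \oo] -->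
    (c `^ a / a)%:E)%E.
  under eq_fun => n.
    rewrite integral_powR_itv ?divr_gt0//; last first.
      by rewrite ltr_pdivrMr// ltr_pMr// ltr1n.
    rewrite -EFinB; over.
  apply: cvg_EFin; first exact: nearW.
  rewrite -[X in _ --> X]subr0; apply: cvgB; first exact: cvg_cst.
  rewrite -[X in _ --> X](mul0r a^-1); apply: cvgM; last exact: cvg_cst.
  apply: ((cvg_at_rightP _ _ _).1 (powR_cvg0 a0)); split => [n|].
    by rewrite divr_gt0.
  rewrite -[X in _ --> X](mulr0 c); apply: cvgM; first exact: cvg_cst.
  have := @cvg_harmonic R.
  by rewrite -(@cvg_shiftS R^o (@harmonic R)).
by rewrite (cvg_unique _ cv1 cv2).
Qed.

(** This is the layer formula for Lebesgue measure, with [Z] the identity and weight y^(a - 1) on y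
    > 0. The inner integral is max(0, h v)^a / a, whence the factor a; the other factor
    [gamma_fun a] undoes the normalization of the density. *)
Lemma gamma_prob_layer (R : realType) (a : R) (A : set R) (h : R -> R) :
  0 < a -> measurable A -> measurable_fun setT h ->
  (forall z v, z <= h v <-> A z /\ z <= v) ->
  (\int[lebesgue_measure]_v (expR (- v) * Num.max 0 (h v) `^ a)%:E =
   (a * gamma_fun a)%:E * gamma_prob a 1 A)%E.
Proof.
move=> a0 mA mh hA; pose w : R -> R := (fun y => y `^ (a - 1)) \_ `]0, +oo[.
have w0 y : 0 <= w y by apply: restrict_ge0 => z _; exact: powR_ge0.
have mw : measurable_fun setT w.
  apply/(measurable_restrict _ (measurable_itv _) measurableT).
  by apply: measurable_funTS; exact: measurable_powR.
have Ga0 := gamma_fun_gt0 a0.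
have layer := @integral_expRN_layer _ _ R lebesgue_measure _ _ _ _
  (@measurable_id _ _ setT) mw w0 mA hA.
transitivity (a%:E * \int[lebesgue_measure]_(y in A) (w y * expR (- y))%:E)%E.
  rewrite layer; transitivity (a%:E * \int[lebesgue_measure]_v
      (a^-1%:E * (expR (- v) * Num.max 0 (h v) `^ a)%:E))%E; last first.
    congr (_ * _)%E; apply: eq_integral => v _.
    by rewrite integral_powR_le// -!EFinM mulrC -mulrA.
  rewrite ge0_integralZl//; last 3 first.
  - apply/measurable_EFinP; apply: measurable_funM.
      by apply: measurableT_comp => //; exact: measurable_funN.
    apply: (measurableT_comp (measurable_powR a)).
    exact: measurable_maxr.
  - by move=> v _; rewrite lee_fin mulr_ge0 ?expR_ge0 ?powR_ge0.
  - by rewrite lee_fin invr_ge0 ltW.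
  by rewrite muleA -EFinM divff ?mul1e// gt_eqF.
rewrite EFinM -muleA; congr (_ * _)%E.
rewrite /gamma_prob -ge0_integralZl//; last 3 first.
- by apply: measurable_funTS; apply/measurable_EFinP; exact: measurable_gamma_pdf.
- by move=> x _; rewrite lee_fin gamma_pdf_ge0.
- by rewrite lee_fin ltW.
apply: eq_integral => y _; rewrite -EFinM; congr EFin.
rewrite /w /gamma_pdf /patch; case: ifPn => _; last by rewrite mulr0 mul0r.
by rewrite powR1 !mul1r !mulrA divff ?gt_eqF// mul1r.
Qed.

Lemma integrable_gamma_kernel (R : realType) (a : R) : 0 < a ->
  lebesgue_measure.-integrable `]0, +oo[ (EFin \o gamma_kernel a).
Proof.
move=> a0; apply/integrableP; split.
  by apply/measurable_EFinP; apply: measurable_gamma_kernel.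
under eq_integral do rewrite /= ger0_norm ?gamma_kernel_ge0//.
exact: gamma_kernel_int_lty.
Qed.

(** * Regular variation at 0: limits, domination and Laplace integrals *)

Section regular_variation.
(** [G] and [H] model t |-> P(Y < t) and t |-> P(Y <= t). The comparisons [G_le_H] and [H_le_G]
    carry the regular variation of [G] over to [H] despite possible atoms. *)
Variables (R : realType) (G H : R -> R) (alpha : R).
Hypotheses (alpha_gt0 : 0 < alpha) (G_nd : {homo G : x y / x <= y}).
Hypotheses (G_gt0 : forall t, 0 < t -> 0 < G t) (G_le1 : forall t, G t <= 1).
Hypotheses (H_nd : {homo H : x y / x <= y}) (H_ge0 : forall t, 0 <= H t).
Hypothesis G_le_H : forall t, G t <= H t.
Hypothesis H_le_G : forall t s, t < s -> H t <= G s.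
Hypothesis G_rv : regularly_varying_at0 G alpha.

(** For v > 0, [H (t * v)] lies between [G (t * v)] and [G (t * s)] for any s > v, and s may
    approach v. For v <= 0 the lower bound is just 0, and a small s > 0 serves above. *)
Lemma regularly_varying_right_lim (v : R) :
  H (t * v) / G t @[t --> 0^'+] --> Num.max 0 v `^ alpha.
Proof.
apply/cvgrPdist_le => e e0.
have e20 : 0 < e / 2 by rewrite divr_gt0.
(* [s] solves s^alpha = p + e / 2: it is positive and above v, and passing from v to s costs e / 2
   in the limit. *)
pose p := Num.max 0 v `^ alpha; pose s := (p + e / 2) `^ alpha^-1.
have p0 : 0 <= p by exact: powR_ge0.
have sE : s `^ alpha = p + e / 2.
  by rewrite -powRrM mulVf ?gt_eqF// powRr1// addr_ge0// ltW.
have s0 : 0 < s by rewrite powR_gt0// ltr_wpDl.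
have vs : v < s.
  apply: (@le_lt_trans _ _ (Num.max 0 v)); first by rewrite le_max lexx orbT.
  rewrite ltNge; apply/negP => sv.
  have : s `^ alpha <= p.
    apply: ge0_ler_powR => //; rewrite ?nnegrE ?(ltW s0) ?(ltW alpha_gt0)//.
    by rewrite le_max lexx.
  by rewrite sE leNgt ltrDl e20.
have /cvgrPdist_le /(_ _ e20) Gs := G_rv s0.
have Gv : \forall t \near 0^'+, p - e / 2 <= H (t * v) / G t.
  have [v0|v0] := leP v 0.
    near=> t; apply: (@le_trans _ _ 0).
      by rewrite /p max_l// powR0 ?gt_eqF// sub0r oppr_le0 ltW.
    by rewrite divr_ge0// ltW// G_gt0.
  have /cvgrPdist_le /(_ _ e20) Gv := G_rv v0.
  near=> t; have t0 : 0 < t by near: t; exact: nbhs_right_gt.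
  apply: (@le_trans _ _ (G (t * v) / G t)).
    rewrite /p max_r ?(ltW v0)// lerBlDl -lerBlDr.
    apply: le_trans (ler_norm _) _; near: t; exact: Gv.
  by rewrite ler_pM2r ?G_le_H// invr_gt0 G_gt0.
near=> t; have t0 : 0 < t by near: t; exact: nbhs_right_gt.
have lo : p - e / 2 <= H (t * v) / G t by near: t.
have hi : H (t * v) / G t <= G (t * s) / G t.
  rewrite ler_pM2r ?invr_gt0 ?G_gt0//; apply: H_le_G.
  by rewrite ltr_pM2l.
have : `|s `^ alpha - G (t * s) / G t| <= e / 2 by near: t.
rewrite sE !ler_norml => /andP[Gs1 Gs2]; rewrite -/p; apply/andP; split; lra.
Unshelve. all: by end_near. Qed.

(* Regular variation with a positive index forbids an atom at [0]. *)
Lemma regularly_varying_no_atom : H 0 = 0.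
Proof.
apply/le_anti; rewrite H_ge0 andbT leNgt; apply/negP => H0.
(* At v = 0 the ratio [H 0 / G t] should tend to 0, but [G t <= 1] keeps it at least [H 0]. *)
have := @regularly_varying_right_lim 0.
rewrite maxxx powR0 ?gt_eqF// => /cvgrPdist_lt /(_ _ H0) H0lt.
near ((0 : R)^'+) => t.
have : `|0 - H (t * 0) / G t| < H 0 by near: t.
have Gt : 0 < G t by apply: G_gt0; near: t; exact: nbhs_right_gt.
rewrite mulr0 sub0r normrN ger0_norm ?divr_ge0 ?(ltW Gt)//.
by rewrite ltr_pdivrMr// ltNge ler_piMr.
Unshelve. all: by end_near. Qed.

(* Potter-type bound: iterating [G (2 t) <= 2 ^ m G t] down to the scale [t0]. *)
Lemma regularly_varying_dominated :
  exists (m : nat) (C t0 : R), [/\ 0 <= C, 0 < t0 &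
    forall t v, 0 < t -> t < t0 -> 0 < v -> H (t * v) / G t <= C * (1 + v ^+ m)].
Proof.
(* With m > alpha, [K] = 2^m lies strictly above 2^alpha, the limit of G(2 t) / G(t), so the
   doubling bound holds for all small t. *)
pose m := (Num.truncn alpha).+2.
have [K KE] : exists K : R, K = 2 ^+ m by exists (2 ^+ m).
have K1 : 1 <= K by rewrite KE exprn_ege1// ler1n.
have K0 : 0 < K by exact: lt_le_trans K1.
have aK : 2 `^ alpha < K.
  apply: (@le_lt_trans _ _ (2 ^+ (Num.truncn alpha).+1)).
    by rewrite -powR_mulrn// ler_powR ?ler1n// ltW// truncnS_gt.
  by rewrite KE ltr_eXn2l// ltr1n.
have [t0 t0_gt0 dbl] : exists2 t0, 0 < t0 &
    forall t, 0 < t -> t < t0 -> G (2 * t) <= K * G t.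
  have : \forall t \near 0^'+, G (t * 2) / G t <= K.
    have := G_rv (ltr0n R 2); move/cvgr_le; exact.
  case=> t0 /= t0_gt0 Ht0; exists t0 => // t tp tt0.
  rewrite mulrC -ler_pdivrMr ?G_gt0//; apply: Ht0 => //=.
  by rewrite sub0r normrN gtr0_norm.
have Gt0 := G_gt0 t0_gt0.
have iter k : forall t, 0 < t -> t < t0 -> G (2 ^+ k * t) <= (G t0)^-1 * K ^+ k * G t.
  elim: k => [t tp tt0|k IH t tp tt0].
    rewrite !expr0 mul1r mulr1 -[leLHS]mul1r ler_pM2r ?G_gt0//.
    by rewrite invf_ge1.
  have -> : 2 ^+ k.+1 * t = 2 ^+ k * (2 * t) by rewrite exprSr mulrA.
  have -> : (G t0)^-1 * K ^+ k.+1 * G t = (G t0)^-1 * K ^+ k * (K * G t).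
    by rewrite exprSr !mulrA.
  have t20 : 0 < 2 * t by rewrite mulr_gt0.
  have Kk : 0 < (G t0)^-1 * K ^+ k by rewrite mulr_gt0 ?invr_gt0// exprn_gt0.
  apply: (@le_trans _ _ ((G t0)^-1 * K ^+ k * G (2 * t))); last first.
    by rewrite ler_pM2l// dbl.
  (* Once 2 t passes [t0] doubling is no longer available; there [G] <= 1 and G(2 t) >= G(t0)
     suffice, which is why the constant contains 1 / G(t0). *)
  have [/IH|t02] := ltP (2 * t) t0; first exact.
  apply: (le_trans (G_le1 _)); rewrite -mulrA ler_pdivlMl// mulr1.
  apply: (@le_trans _ _ (G (2 * t))); first exact: G_nd.
  by apply: ler_peMl; [exact/ltW/G_gt0|exact: exprn_ege1].
exists m, ((G t0)^-1 * K), t0; split => //.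
  by rewrite mulr_ge0 ?invr_ge0// ltW.
move=> t v tp tt0 v0.
have ex : exists k, v < 2 ^+ k.
  exists (Num.truncn v).+1; apply: lt_trans (truncnS_gt v) _.
  by rewrite -natrX ltr_nat ltn_expl.
(* For the least k with v < 2^k, either k = 0 and the summand 1 is enough, or 2^(k - 1) <= v and K^k
   = K (2^(k - 1))^m <= K v^m. *)
case: (ex_minnP ex) => k vk kmin.
rewrite ler_pdivrMr ?G_gt0//; apply: (@le_trans _ _ (G (2 ^+ k * t))).
  by apply: H_le_G; rewrite mulrC ltr_pM2r.
apply: (le_trans (iter k t tp tt0)).
rewrite ler_pM2r ?G_gt0// -!mulrA ler_pM2l ?invr_gt0//.
case: k vk kmin {iter} => [|k] vk kmin.
  rewrite expr0; apply: mulr_ege1 => //.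
  by rewrite lerDl exprn_ge0 ?(ltW v0).
rewrite exprS ler_pM2l//; have kv : 2 ^+ k <= v.
  by rewrite leNgt; apply/negP => /kmin; rewrite ltnn.
rewrite KE -exprM mulnC exprM; apply: ler_wpDl => //.
by rewrite ler_pXn2r// nnegrE ?exprn_ge0// ltW.
Qed.


(** Dominated convergence: [regularly_varying_right_lim] gives the pointwise limit, and [h v <= v]
    lets the Potter bound at v control the integrand for every truncation [h]. *)
Lemma regularly_varying_laplace (h : R -> R) (t : nat -> R) :
  measurable_fun setT h -> (forall v, h v <= v) ->
  t n @[n --> \oo] --> 0^'+ ->
  (\int[lebesgue_measure]_v (expR (- v) * (H (t n * h v) / G (t n)))%:E
     @[n --> \oo] -->
   \int[lebesgue_measure]_v (expR (- v) * Num.max 0 (h v) `^ alpha)%:E)%E.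
Proof.
move=> mh hv t0; have mexp : measurable_fun setT (fun v : R => expR (- v)).
  by apply: measurableT_comp => //; exact: measurable_funN.
have [m [C [s [C0 s0 dom]]]] := regularly_varying_dominated.
have : \forall x \near 0^'+, 0 < x < s.
  near=> x; apply/andP; split; near: x.
    exact: nbhs_right_gt.
  exact: nbhs_right_lt.
move=> /t0[N _ Nts].
(* Dropping the first N terms puts every [t n] in the range ]0, s[ of the Potter bound. *)
rewrite -(cvg_shiftn N).
(* On v > 0, exp(- v) (1 + v^m) is the sum of the gamma kernels with parameters 1 and m + 1, hence
   integrable. *)
pose g : R -> \bar R := (fun v => C%:E * ((EFin \o gamma_kernel 1) v +
  (EFin \o gamma_kernel m.+1%:R) v))%E \_ `]0, +oo[.
have ig : lebesgue_measure.-integrable setT g.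
  rewrite /g -integrable_mkcond; last exact: measurable_itv.
  apply: integrableZl; first exact: measurable_itv.
  by apply: integrableD; [exact: measurable_itv|exact: integrable_gamma_kernel..].
pose fn n v := (expR (- v) * (H (t (n + N)%N * h v) / G (t (n + N)%N)))%:E.
have [|||||_ _] := @dominated_convergence _ _ _ lebesgue_measure setT measurableT
  fn (fun v => (expR (- v) * Num.max 0 (h v) `^ alpha)%:E) g => //.
- move=> n; apply/measurable_EFinP; apply: measurable_funM => //.
  apply: measurable_funM => //.
  apply: (measurableT_comp (nondecreasing_measurable _ H_nd)) => //.
  exact: measurable_funM.
- apply/measurable_EFinP; apply: measurable_funM => //.
  by apply: (measurableT_comp (measurable_powR alpha)); exact: measurable_maxr.
- apply: aeW => v _; apply: cvg_EFin; first exact: nearW.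
  apply: cvgM; first exact: cvg_cst.
  have := cvg_comp _ _ t0 (@regularly_varying_right_lim (h v)).
  by rewrite -(cvg_shiftn N).
- apply: aeW => v n _; have /andP[tp ts] : 0 < t (n + N)%N < s.
    by apply: Nts => /=; rewrite leq_addl.
  rewrite /fn /g /patch /= mem_setE in_itv/= andbT; case: ltP => v0; last first.
    (* For v <= 0 the bound [g] is 0, so the integrand must vanish: its argument is nonpositive and
       [H 0] = 0. *)
    suff -> : H (t (n + N)%N * h v) = 0 by rewrite mul0r mulr0 normr0.
    apply/le_anti; rewrite H_ge0 andbT -regularly_varying_no_atom; apply: H_nd.
    by rewrite pmulr_rle0// (le_trans (hv v)).
  rewrite lee_fin ger0_norm; last first.
    by rewrite mulr_ge0 ?expR_ge0// divr_ge0// ltW// G_gt0.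
  rewrite /gamma_kernel subrr powRr0 mul1r -natr1 addrK powR_mulrn ?(ltW v0)//.
  rewrite [leRHS](_ : _ = expR (- v) * (C * (1 + v ^+ m))); last by ring.
  rewrite ler_pM2l ?expR_gt0//.
  apply: le_trans (dom _ _ tp ts v0).
  rewrite ler_pM2r ?invr_gt0 ?G_gt0//; apply: H_nd.
  by rewrite ler_pM2l.
Unshelve. all: by end_near. Qed.

End regular_variation.

(** * The gap between [X] and its right endpoint *)

Section endpoint.
Variables (R : realType) (d : measure_display) (T : measurableType d).
Variables (P : probability T R) (X : {RV P >-> R}).
Local Notation M := (right_endpoint X).

(** This is P(M - X < t), in the form in which [weibull_regime] asserts regular variation; it plays
    the role of [G], and [gap_cdf] that of [H]. *)
Definition survival (t : R) : R := 1 - fine (cdf X (M - t)).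

Definition gap_cdf (t : R) : R := fine (P [set w | M - X w <= t]).

Lemma measurable_gap (t : R) : measurable [set w | M - X w <= t].
Proof.
rewrite -[X in measurable X]setTI; apply: measurable_fun_le => //.
exact: measurable_funB.
Qed.

Lemma measurable_gap_lt (t : R) : measurable [set w | M - X w < t].
Proof.
rewrite (_ : [set w | _] = ~` [set w | t <= M - X w]); last first.
  by apply/seteqP; split=> w /=; rewrite ltNge => /negP.
apply: measurableC; rewrite -[X in measurable X]setTI.
by apply: measurable_fun_le => //; exact: measurable_funB.
Qed.

Lemma gap_cdfE (t : R) : (gap_cdf t)%:E = P [set w | M - X w <= t].
Proof. by rewrite /gap_cdf fineK// fin_num_measure//; exact: measurable_gap. Qed.

Lemma cdf_fin_num (t : R) : cdf X t \is a fin_num.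
Proof. exact: fin_num_measure. Qed.

Lemma survivalE (t : R) : (survival t)%:E = P [set w | M - X w < t].
Proof.
rewrite /survival EFinB fineK ?cdf_fin_num// -[1%E](cdf_ccdf_1 X (M - t)).
rewrite addeAC subee ?cdf_fin_num// add0e.
congr (P _); apply/seteqP; split => w /=; rewrite in_itv/= andbT; lra.
Qed.

Lemma survival_le1 (t : R) : survival t <= 1.
Proof. by rewrite -lee_fin survivalE probability_le1//; exact: measurable_gap_lt. Qed.

Lemma survival_nd : {homo survival : x y / x <= y}.
Proof.
move=> x y xy; rewrite lerD2l lerN2 fine_le ?cdf_fin_num//.
by apply: cdf_nondecreasing; rewrite lerD2l lerN2.
Qed.

Lemma gap_cdf_ge0 (t : R) : 0 <= gap_cdf t.
Proof. exact: fine_ge0. Qed.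

Lemma gap_cdf_nd : {homo gap_cdf : x y / x <= y}.
Proof.
move=> x y xy; rewrite -lee_fin !gap_cdfE le_measure ?inE//; [exact: measurable_gap..|].
by move=> w /= /le_trans; exact.
Qed.

Lemma survival_le_gap_cdf (t : R) : survival t <= gap_cdf t.
Proof.
rewrite -lee_fin survivalE gap_cdfE le_measure ?inE//.
- exact: measurable_gap_lt.
- exact: measurable_gap.
- by move=> w /= /ltW.
Qed.

Lemma gap_cdf_le_survival (t s : R) : t < s -> gap_cdf t <= survival s.
Proof.
move=> ts; rewrite -lee_fin survivalE gap_cdfE le_measure ?inE//.
- exact: measurable_gap.
- exact: measurable_gap_lt.
- by move=> w /= /le_lt_trans; exact.
Qed.

Hypothesis X_bounded : bounded_above X.

(** Ensures that [right_endpoint] is a genuine supremum and not a default value of [sup]. The set is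
    nonempty because the cdf tends to 0 at -oo, and an almost sure upper bound of [X] bounds it. *)
Lemma has_sup_cdf_lt1 : has_sup [set x : R | (cdf X x < 1)%E].
Proof.
split.
  have [B [_ XB]] := @cvg_cdfNy0 _ _ _ _ X _ (open_ereal_lt' lte01).
  by exists (B - 1); apply: XB; rewrite gtrBl.
have [B [N [mN N0 NB]]] := X_bounded.
exists B => x /= x1; rewrite leNgt; apply/negP => Bx; move: x1.
rewrite ltNge => /negP; apply; rewrite -(cdf_ccdf_1 X x).
rewrite -[leRHS]adde0 leeD2l//.
have mX : measurable (X @^-1` `]x, +oo[).
  by rewrite -[X in measurable X]setTI; exact: measurable_funP.
rewrite -N0 [leLHS](_ : _ = P (X @^-1` `]x, +oo[))//; apply: le_measure; rewrite ?inE//.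
move=> w /=; rewrite in_itv/= andbT => xX; apply: NB => /= XB.
by have := lt_trans Bx xX; rewrite ltNge XB.
Qed.

(** Below the supremum M some x > M - t still has cdf less than 1. This permits division by
    [survival]. *)
Lemma survival_gt0 (t : R) : 0 < t -> 0 < survival t.
Proof.
move=> t0; rewrite /survival subr_gt0.
have [x /= x1 Mx] := sup_adherent t0 has_sup_cdf_lt1.
rewrite -lte_fin fineK ?cdf_fin_num//; apply: le_lt_trans x1.
by apply: cdf_nondecreasing; exact: ltW.
Qed.

(** Writing theta X = theta M - Z with Z = theta (M - X), the layer formula applies to Z under [P]
    with weight 1. The prefactor does not depend on [A], so it cancels in the tilted probability;
    dividing by [survival] gives the integrand a limit. *)
Lemma expectation_tilt (theta : R) (A : set R) (h : R -> R) : 0 < theta ->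
  measurable A -> measurable_fun setT h ->
  (forall z v, z <= h v <-> A z /\ z <= v) ->
  ('E_P[(fun w => expR (theta * X w) *
         \1_[set w | A (theta * (M - X w))%R] w)%R] =
  (expR (theta * M) * survival theta^-1)%:E *
  \int[lebesgue_measure]_v (expR (- v) *
     (gap_cdf (theta^-1 * h v) / survival theta^-1))%:E)%E.
Proof.
move=> th0 mA mh hA; pose Z w := theta * (M - X w).
have mZ : measurable_fun setT Z.
  by apply: measurable_funM => //; exact: measurable_funB.
have S0 : 0 < survival theta^-1 by rewrite survival_gt0// invr_gt0.
have mS : measurable_fun setT (fun v : R => expR (- v) *
     (gap_cdf (theta^-1 * h v) / survival theta^-1)).
  apply: measurable_funM.
    by apply: measurableT_comp => //; exact: measurable_funN.
  apply: measurable_funM => //.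
  apply: (measurableT_comp (nondecreasing_measurable _ gap_cdf_nd)) => //.
  exact: measurable_funM.
transitivity ((expR (theta * M))%:E * \int[P]_(w in Z @^-1` A) (1 * expR (- Z w))%:E)%E.
  rewrite unlock -ge0_integralZl//; last 2 first.
  - by rewrite -[X in measurable X]setTI; exact: mZ.
  - apply: measurable_funTS; apply/measurable_EFinP; apply: measurable_funM => //.
    by apply: measurableT_comp => //; exact: measurable_funN.
  rewrite [RHS]integral_mkcond; apply: eq_integral => w _.
  rewrite /patch indicE -EFinM mul1r -expRD; case: (w \in _); last by rewrite mulr0.
  by rewrite mulr1 /Z; congr (expR _)%:E; ring.
rewrite (@integral_expRN_layer _ _ R P _ (cst 1) _ _ mZ _ _ mA hA)//.
rewrite EFinM -muleA; congr (_ * _)%E.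
rewrite -ge0_integralZl//; last 3 first.
- exact/measurable_EFinP.
- move=> v _; rewrite lee_fin mulr_ge0 ?expR_ge0// divr_ge0 ?gap_cdf_ge0//.
  exact: ltW.
- by rewrite lee_fin ltW.
apply: eq_integral => v _.
have mD : measurable [set w | Z w <= h v].
  by rewrite -[X in measurable X]setTI; exact: measurable_fun_le.
rewrite [X in (_ * X)%E](etrans (integral_cst P mD 1%E) (mul1e _)).
rewrite -EFinM mulrCA [survival _ * _]mulrC divfK; last by rewrite gt_eqF.
rewrite EFinM gap_cdfE; congr (_ * P _)%E.
by apply/seteqP; split => w /=; rewrite ler_pdivlMl.
Qed.

End endpoint.

(** * Convergence of the tilted distribution functions *)

Theorem theorem5 (R : realType) (d : measure_display) (T : measurableType d)
    (P : probability T R) (X : {RV P >-> R}) (alpha : R)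
    (X_bounded : bounded_above X)
    (alpha_gt0 : 0 < alpha)
    (X_weibull : weibull_regime X alpha)
    (d' : R -> measure_display)
    (T' : forall theta : R, measurableType (d' theta))
    (P' : forall theta : R, probability (T' theta) R)
    (Xtilt : forall theta : R, {RV (P' theta) >-> R})
    (Xtilt_law : forall theta : R, 0 < theta ->
       has_tilted_law X theta (Xtilt theta))
    (theta : nat -> R)
    (theta_cvg : theta n @[n --> \oo] --> +oo) :
  cvg_in_distribution
    (fun n => cst (theta n) \* (cst (right_endpoint X) \- Xtilt (theta n))
       : {RV (P' (theta n)) >-> R})
    (gamma_probability alpha_gt0 ltr01).
Proof.
move=> x _; have thetaV : (theta n)^-1 @[n --> \oo] --> 0^'+.
  have V0 : (theta n)^-1 @[n --> \oo] --> 0.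
    by apply/gtr0_cvgV0; [exact: (cvgryPgt _).1 theta_cvg 0|exact: theta_cvg].
  move=> B [e /= e0 eB]; move/cvgrPdist_lt: V0 => /(_ _ e0) V0.
  suff : \forall n \near \oo, B (theta n)^-1 by [].
  near=> n; apply: eB => /=; first by near: n; exact: V0.
  by rewrite invr_gt0; near: n; exact: (cvgryPgt _).1 theta_cvg 0.
pose J h n := (\int[lebesgue_measure]_v (expR (- v) *
  (gap_cdf X ((theta n)^-1 * h v) / survival X (theta n)^-1))%:E)%E.
pose Gm := alpha * gamma_fun alpha.
have Gm0 : 0 < Gm by rewrite mulr_gt0// gamma_fun_gt0.
(* [regularly_varying_laplace] along t = 1 / theta n gives the limit, and [gamma_prob_layer]
   identifies it. *)
have J_cvg (A : set R) (h : R -> R) : measurable A -> measurable_fun setT h ->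
    (forall z v, z <= h v <-> A z /\ z <= v) ->
    J h n @[n --> \oo] --> (Gm * fine (gamma_prob alpha 1 A))%:E.
  move=> mA mh hA; rewrite EFinM fineK; last first.
    exact: (fin_num_measure (gamma_probability alpha_gt0 ltr01)).
  rewrite -(gamma_prob_layer alpha_gt0 mA mh hA).
  apply: (regularly_varying_laplace alpha_gt0 (@survival_nd _ _ _ _ X)
    (survival_gt0 X_bounded) (@survival_le1 _ _ _ _ X) (@gap_cdf_nd _ _ _ _ X)
    (@gap_cdf_ge0 _ _ _ _ X) (@survival_le_gap_cdf _ _ _ _ X)
    (@gap_cdf_le_survival _ _ _ _ X) X_weibull mh _ thetaV).
  by move=> v; have [_] := (hA (h v) v).1 (lexx _).
have hx z v : z <= Num.min v x <-> `]-oo, x]%classic z /\ z <= v.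
  rewrite le_min /= in_itv/=; split; first by move=> /andP[].
  by move=> [-> ->].
have hT (z v : R) : z <= id v <-> [set: R] z /\ z <= v by split => // -[].
have mx : measurable_fun setT (fun v : R => Num.min v x) by exact: measurable_minr.
have mT : measurable_fun setT (@id R) by [].
have Jx := J_cvg _ _ (measurable_itv _) mx hx.
have JT := J_cvg _ _ measurableT mT hT.
have pT : gamma_prob alpha 1 [set: R] = 1%E by exact: gamma_prob_setT.
rewrite pT mulr1 in JT.
(* The target is written as the quotient of the limits for ]-oo, x] and for the whole line, the
   latter being [Gm]. *)
have -> : gamma_probability alpha_gt0 ltr01 `]-oo, x]%classic =
    (Gm * fine (gamma_prob alpha 1 `]-oo, x]) / Gm)%:E.
  rewrite mulrAC divff ?gt_eqF// mul1r fineK//.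
  exact: (fin_num_measure (gamma_probability alpha_gt0 ltr01)).
have [Jx_fin fJx] := (fine_cvgP _ _).1 Jx.
have [JT_fin fJT] := (fine_cvgP _ _).1 JT.
suff lim : (fine (J (fun v => Num.min v x) n) / fine (J id n))%:E @[n --> \oo] -->
    (Gm * fine (gamma_prob alpha 1 `]-oo, x]) / Gm)%:E.
  apply: cvg_trans lim; apply: near_eq_cvg; near=> n.
  have th0 : 0 < theta n by near: n; exact: (cvgryPgt _).1 theta_cvg 0.
  (* The rescaled variable is at most x exactly when [Xtilt (theta n)] lies in [A], so its cdf at x
     is a tilted probability. *)
  pose A := (fun a => theta n * (right_endpoint X - a)) @^-1` `]-oo, x]%classic.
  have mA : measurable A.
    rewrite -[X in measurable X]setTI; apply: measurable_funM => //.
    exact: measurable_funB.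
  transitivity (distribution (P' (theta n)) (Xtilt (theta n)) A); last by [].
  rewrite Xtilt_law//.
  have e0 : 0 < expR (theta n * right_endpoint X) by exact: expR_gt0.
  have s0 : 0 < survival X (theta n)^-1 by rewrite survival_gt0// invr_gt0.
  rewrite (expectation_tilt X_bounded th0 (measurable_itv _) mx hx) -/(J _ n).
  have -> : ('E_P[(fun w => expR (theta n * X w))%R] =
      (expR (theta n * right_endpoint X) * survival X (theta n)^-1)%:E * J id n)%E.
    rewrite -(expectation_tilt X_bounded th0 measurableT mT hT).
    by congr expectation; apply/funext => w; rewrite indicT mulr1.
  have Jxn : J (fun v => Num.min v x) n \is a fin_num by near: n.
  have JTn : J id n \is a fin_num by near: n.
  (* The denominator is eventually positive because its limit [Gm] is. *)
  have JT0 : 0 < fine (J id n).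
    by near: n; exact: (cvgr_gt _ fJT).
  rewrite -(fineK Jxn) -(fineK JTn) -!EFinM inver gt_eqF ?mulr_gt0//.
  rewrite -EFinM; congr EFin; field.
  by rewrite (gt_eqF JT0) (gt_eqF s0) (gt_eqF e0).
apply: cvg_EFin; first exact: nearW.
apply: cvgM; first exact: fJx.
by apply: cvgV => //; rewrite gt_eqF.
Unshelve. all: by end_near. Qed.
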